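(* Every multilinear polynomial identity of degree $\le 3$ satisfied by the partially alternating ternary sum (over $\mathbb{Q}$) is a consequence of the identity $P(a,b,c)\equiv 0$, where $P(a,b,c)=(a,b,c)+(a,c,b)$.
   Context: The base field is $\mathbb{Q}$. An (associative) dialgebra is a vector space $A$ with two bilinear products $\dashv,\vdash$ satisfying $(a\dashv b)\dashv c=a\dashv(b\dashv c)$, $(a\vdash b)\vdash c=a\vdash(b\vdash c)$, $(a\vdash b)\dashv c=a\vdash(b\dashv c)$, $(a\dashv b)\vdash c=(a\vdash b)\vdash c$, $a\dashv(b\dashv c)=a\dashv(b\vdash c)$. The partially alternating ternary sum (PATS) is the trilinear operation on a dialgebra $$[a,b,c]=a\dashv b\dashv c-a\dashv c\dashv b-b\vdash a\dashv c+c\vdash a\dashv b+b\vdash c\vdash a-c\vdash b\vdash a .$$ A ternary algebra is a vector space with a trilinear product $(\cdot,\cdot,\cdot)$. A (ternary) polynomial of degree $n$ is a linear combination of monomials of degree $n$ in the free (nonassociative) ternary algebra on a set of variables; it is multilinear if each of $n$ variables occurs exactly once in each monomial. A polynomial identity $f\equiv 0$ is satisfied by the PATS if $f$ vanishes for all values of the variables in every dialgebra when $(\cdot,\cdot,\cdot)$ is interpreted as the PATS. An identity is a consequence of a set of identities if it holds in every ternary algebra over $\mathbb{Q}$ satisfying all the identities of that set. *)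

(* Defs.v *)
From HB Require Import structures.
From mathcomp Require Import all_boot ssralg ssrint rat sesquilinear.
From mathcomp Require Import freeg.

Set Implicit Arguments.
Unset Strict Implicit.
Unset Printing Implicit Defensive.

Import GRing.Theory.
Local Open Scope ring_scope.

(* lprod is the product written with the left tack (dashv), rprod the one
   written with the right tack (vdash). *)
Record dialgebra := Dialgebra {
  dialg_sort :> lmodType rat;
  lprod : {bilinear dialg_sort -> dialg_sort -> dialg_sort};
  rprod : {bilinear dialg_sort -> dialg_sort -> dialg_sort};
  lprodA : forall a b c, lprod (lprod a b) c = lprod a (lprod b c);
  rprodA : forall a b c, rprod (rprod a b) c = rprod a (rprod b c);
  innerA : forall a b c, lprod (rprod a b) c = rprod a (lprod b c);
  left_bar : forall a b c, rprod (lprod a b) c = rprod (rprod a b) c;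
  right_bar : forall a b c, lprod a (lprod b c) = lprod a (rprod b c)
}.

Record ternary_algebra := TernaryAlgebra {
  ternary_sort :> lmodType rat;
  tprod : ternary_sort -> ternary_sort -> ternary_sort -> ternary_sort;
  tprod_linear1 : forall b c, linear (fun a => tprod a b c);
  tprod_linear2 : forall a c, linear (fun b => tprod a b c);
  tprod_linear3 : forall a b, linear (fun c => tprod a b c)
}.

Section PATS.
Variable D : dialgebra.
Local Notation "a ⊣ b" := (lprod D a b) (at level 40, left associativity).
Local Notation "a ⊢ b" := (rprod D a b) (at level 40, left associativity).

(* Bracketed to the left; by lprodA, rprodA and innerA the bracketing of each
   of the six terms is immaterial. *)
Definition pats (a b c : D) : D :=
  a ⊣ b ⊣ c - a ⊣ c ⊣ b - b ⊢ a ⊣ c + c ⊢ a ⊣ b + b ⊢ c ⊢ a - c ⊢ b ⊢ a.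

Let addBl (u u' v v' : D) k :
  (k *: u + u') - (k *: v + v') = k *: (u - v) + (u' - v').
Proof. by rewrite scalerBr opprD addrACA. Qed.

Let addDl (u u' v v' : D) k :
  (k *: u + u') + (k *: v + v') = k *: (u + v) + (u' + v').
Proof. by rewrite scalerDr addrACA. Qed.

Fact pats_linear1 b c : linear (fun a => pats a b c).
Proof.
by move=> k u v; rewrite /pats !(linearPl, linearPr) !(addBl, addDl).
Qed.

Fact pats_linear2 a c : linear (fun b => pats a b c).
Proof.
by move=> k u v; rewrite /pats !(linearPl, linearPr) !(addBl, addDl).
Qed.

Fact pats_linear3 a b : linear (fun c => pats a b c).
Proof.
by move=> k u v; rewrite /pats !(linearPl, linearPr) !(addBl, addDl).
Qed.

Definition pats_algebra : ternary_algebra :=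
  TernaryAlgebra pats_linear1 pats_linear2 pats_linear3.

End PATS.

Inductive tmonomial (X : Type) : Type :=
| TVar of X
| TProd of tmonomial X & tmonomial X & tmonomial X.

Arguments TVar {X} _.
Arguments TProd {X} _ _ _.

Section TMonomialChoice.
Variable X : Type.

Fixpoint tmonomial_encode (m : tmonomial X) : GenTree.tree X :=
  match m with
  | TVar x => GenTree.Leaf x
  | TProd p q r =>
      GenTree.Node 0 [:: tmonomial_encode p; tmonomial_encode q;
                         tmonomial_encode r]
  end.

Fixpoint tmonomial_decode (t : GenTree.tree X) : option (tmonomial X) :=
  match t with
  | GenTree.Leaf x => Some (TVar x)
  | GenTree.Node _ [:: p; q; r] =>
      match tmonomial_decode p, tmonomial_decode q, tmonomial_decode r with
      | Some p', Some q', Some r' => Some (TProd p' q' r')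
      | _, _, _ => None
      end
  | _ => None
  end.

Fact tmonomial_encodeK : pcancel tmonomial_encode tmonomial_decode.
Proof. by elim=> //= p -> q -> r ->. Qed.

End TMonomialChoice.

HB.instance Definition _ (X : eqType) :=
  Equality.copy (tmonomial X) (pcan_type (@tmonomial_encodeK X)).
HB.instance Definition _ (X : choiceType) :=
  Choice.copy (tmonomial X) (pcan_type (@tmonomial_encodeK X)).

Fixpoint tvars (X : Type) (m : tmonomial X) : seq X :=
  match m with
  | TVar x => [:: x]
  | TProd p q r => tvars p ++ tvars q ++ tvars r
  end.

(* The underlying vector space of the free ternary algebra on X. *)
Notation tpoly X := {freeg (tmonomial X) / rat}.

Definition multilinear (X : choiceType) (n : nat) (f : tpoly X) : Prop :=
  exists2 s : seq X, uniq s /\ size s = n &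
    forall m, m \in dom f -> perm_eq (tvars m) s.

Fixpoint meval (X : Type) (T : ternary_algebra) (v : X -> T)
    (m : tmonomial X) : T :=
  match m with
  | TVar x => v x
  | TProd p q r => tprod (meval v p) (meval v q) (meval v r)
  end.

Definition satisfies (X : choiceType) (T : ternary_algebra) (f : tpoly X) :
    Prop :=
  forall v : X -> T, fglift (meval v) f = 0.

Definition satisfied_by_pats (X : choiceType) (f : tpoly X) : Prop :=
  forall D : dialgebra, satisfies (pats_algebra D) f.

Definition consequence (X Y : choiceType) (S : tpoly Y -> Prop) (f : tpoly X) :
    Prop :=
  forall T : ternary_algebra, (forall g, S g -> satisfies T g) -> satisfies T f.

(* (a, b, c) + (a, c, b) in the variables a = 0, b = 1, c = 2. *)
Definition P_abc : tpoly nat :=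
  << TProd (TVar 0%N) (TVar 1%N) (TVar 2%N) >> +
  << TProd (TVar 0%N) (TVar 2%N) (TVar 1%N) >>.

(* Main.v *)
(* Monomials have odd degree, so only degrees 1 and 3 matter. Since P makes the
   product alternating in its last two arguments, in degree 3 it suffices to
   show that the coefficients of (x,y,z) and (x,z,y) agree. This is detected by
   a split null extension of an associative algebra A by a bimodule N: there,
   every dialgebra monomial with an argument from N away from its center
   vanishes, so choosing x in N and y, z in A isolates the terms (x,y,z) and
   (x,z,y), on which the PATS takes the values x[y,z] and -x[y,z]. *)
Require Import Defs.
From mathcomp Require Import all_boot ssralg rat freeg.
From HB Require Import structures.
From mathcomp Require Import matrix sesquilinear zify.

Set Implicit Arguments.
Unset Strict Implicit.
Unset Printing Implicit Defensive.

Import GRing.Theory.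
Local Open Scope ring_scope.

(* Here N is A with its regular right action and the zero left action. *)
Section SplitNullExtension.
Variable A : algType rat.
Local Notation E := (A * A)%type.

(** With π the projection of E onto A, these are x π(y) and π(x) y; the zero left action kills the
    second component of the latter. *)
Definition ext_lprod (a b : E) : E := (a.1 * b.1, a.2 * b.1).
Definition ext_rprod (a b : E) : E := (a.1 * b.1, 0).

Fact ext_lprod_bilinear : bilinear_for *:%R *:%R ext_lprod.
Proof.
by split=> [b|a] k u v; congr pair => /=;
  rewrite ?mulrDl ?mulrDr -?scalerAl -?scalerAr.
Qed.

Fact ext_rprod_bilinear : bilinear_for *:%R *:%R ext_rprod.
Proof.
by split=> [b|a] k u v; congr pair => /=;
  rewrite ?mulrDl ?mulrDr -?scalerAl -?scalerAr ?scaler0 ?addr0.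
Qed.

HB.instance Definition _ :=
  bilinear_isBilinear.Build rat E E E *:%R *:%R ext_lprod ext_lprod_bilinear.
HB.instance Definition _ :=
  bilinear_isBilinear.Build rat E E E *:%R *:%R ext_rprod ext_rprod_bilinear.

Definition ext_dialgebra : dialgebra.
Proof.
by refine (@Dialgebra E ext_lprod ext_rprod _ _ _ _ _) => a b c;
  congr pair => /=; rewrite ?mulrA ?mul0r.
Defined.

(** All six terms of the PATS have the first argument as center, and the zero left action kills the
    four with a factor to its left. *)
Lemma pats_ext (x y z : A) :
  pats ((0, x) : ext_dialgebra) (y, 0) (z, 0) = (0, x * (y * z - z * y)).
Proof.
rewrite /pats /= /ext_lprod /ext_rprod /=; congr pair => /=.
  by rewrite ?(mul0r, mulr0) ?(subr0, addr0).
by rewrite !mul0r mulrBr !mulrA ?(subr0, addr0).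
Qed.

(** The center is now [(y, 0)], and [(0, x)] acts only through its projection to A, which is 0. *)
Lemma pats_ext_off_center (x y : A) (b : ext_dialgebra) :
  pats ((y, 0) : ext_dialgebra) (0, x) b = 0 /\
  pats ((y, 0) : ext_dialgebra) b (0, x) = 0.
Proof.
by split; rewrite /pats /= /ext_lprod /ext_rprod /=; congr pair => /=;
  rewrite ?(mul0r, mulr0) ?(subr0, addr0).
Qed.

End SplitNullExtension.

Lemma pats_separation : exists (D : dialgebra) (a b c : D),
  [/\ pats a b c != 0, pats a c b = - pats a b c,
      pats b a c = 0, pats b c a = 0 & pats c a b = 0 /\ pats c b a = 0].
Proof.
(* Opposite matrix units: the commutator of [y] and [z] is diag(1, -1), seen to be nonzero at its
   top left entry. *)
pose y : 'M[rat]_2 := delta_mx ord0 ord_max.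
pose z : 'M[rat]_2 := delta_mx ord_max ord0.
exists (ext_dialgebra 'M[rat]_2), (0, 1), (y, 0), (z, 0).
split.
- rewrite pats_ext mul1r; apply/eqP => -[/matrixP/(_ ord0 ord0)].
  by rewrite /y /z -!mulmxE !mul_delta_mx !mxE.
- by rewrite !pats_ext !mul1r; congr pair; rewrite ?oppr0 // opprB.
- by have [] := pats_ext_off_center 1 y (z, 0).
- by have [] := pats_ext_off_center 1 y (z, 0).
- by have [] := pats_ext_off_center 1 z (y, 0).
Qed.

Section Evaluation.
Variables (R : nzRingType) (K : choiceType) (V : lmodType R).

(** Allows expansion over an explicit list although [dom f] is unknown: coefficients outside the
    support are 0. *)
Lemma fglift_sum (h : K -> V) (f : {freeg K / R}) (s : seq K) :
  uniq s -> {subset dom f <= s} ->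
  fglift h f = \sum_(m <- s) coeff m f *: h m.
Proof.
move=> us fs; rewrite -[in LHS](Freeg_dom f) fglift_Freeg /prelift big_map /=.
rewrite [RHS](bigID (mem (dom f)) xpredT) /= [X in _ + X]big1; last first.
  by move=> m /coeff_outdom ->; rewrite scale0r.
rewrite addr0 -[RHS]big_filter; apply: perm_big; apply: uniq_perm.
- exact: uniq_dom.
- exact: filter_uniq.
- by move=> m; rewrite mem_filter; case: (boolP (m \in dom f)) => // /fs ->.
Qed.

End Evaluation.

Definition var_prod (X : Type) (x y z : X) : tmonomial X :=
  TProd (TVar x) (TVar y) (TVar z).

(** Every factor contains a variable, so the three factors of a product have exactly one each. *)
Lemma tmonomial_small (X : Type) (m : tmonomial X) : (size (tvars m) <= 3)%N ->
  (exists x, m = TVar x) \/ (exists x y z, m = var_prod x y z).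
Proof.
have pos (p : tmonomial X) : (0 < size (tvars p))%N.
  by elim: p => //= p p0 q _ r _; rewrite size_cat addn_gt0 p0.
have var (p : tmonomial X) : (size (tvars p) <= 1)%N -> exists x, p = TVar x.
  case: p => [x|p q r] /=; first by exists x.
  by rewrite !size_cat; have := (pos p, pos q) => -[]; lia.
case: m => [x|p q r] /=; first by left; exists x.
rewrite !size_cat => le3; right; have [[p0 q0] r0] := (pos p, pos q, pos r).
have /var[x ->] : (size (tvars p) <= 1)%N by lia.
have /var[y ->] : (size (tvars q) <= 1)%N by lia.
have /var[z ->] : (size (tvars r) <= 1)%N by lia.
by exists x, y, z.
Qed.

Definition orderings (X : Type) (x y z : X) : seq (tmonomial X) :=
  [:: var_prod x y z; var_prod x z y; var_prod y x z; var_prod y z x;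
      var_prod z x y; var_prod z y x].

Lemma var_prod_eq (X : eqType) (x y z x' y' z' : X) :
  (var_prod x y z == var_prod x' y' z') = [&& x == x', y == y' & z == z'].
Proof.
by apply/eqP/and3P => [[-> -> ->]//|[/eqP-> /eqP-> /eqP->]].
Qed.

Lemma orderings_uniq (X : choiceType) (x y z : X) :
  uniq [:: x; y; z] -> uniq (orderings x y z).
Proof.
rewrite /= !inE negb_or !andbT => /andP[/andP[/negPf xy /negPf xz] /negPf yz].
by rewrite !var_prod_eq !(eq_sym y x, eq_sym z x, eq_sym z y) xy xz yz !andbF.
Qed.

Lemma mem_orderings (X : eqType) (x y z x' y' z' : X) :
  uniq [:: x; y; z] -> perm_eq [:: x'; y'; z'] [:: x; y; z] ->
  var_prod x' y' z' \in orderings x y z.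
Proof.
move=> us ps; have := perm_uniq ps; rewrite us.
have := perm_mem ps x'; have := perm_mem ps y'; have := perm_mem ps z'.
(* Of the 27 assignments, those with a repeated variable contradict uniqueness. *)
rewrite !inE !eqxx ?orbT /= => /esym/or3P[]/eqP-> /esym/or3P[]/eqP->;
  move=> /esym/or3P[]/eqP->; by rewrite ?inE ?eqxx ?orbT ?andbF.
Qed.

Lemma dom_sub_orderings (X : choiceType) (f : tpoly X) (x y z : X) :
  uniq [:: x; y; z] ->
  (forall m, m \in dom f -> perm_eq (tvars m) [:: x; y; z]) ->
  {subset dom f <= orderings x y z}.
Proof.
move=> us fs m /fs ms; have : (size (tvars m) <= 3)%N by rewrite (perm_size ms).
move=> /tmonomial_small[[t mE]|[p [q [r mE]]]]; rewrite mE in ms *.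
  by move/perm_size: ms.
exact: mem_orderings.
Qed.

(** At the separating elements, evaluation leaves only the difference of the two coefficients times
    the nonzero [pats a b c]. *)
Lemma coeff_swap (X : choiceType) (f : tpoly X) (x y z : X) :
  uniq [:: x; y; z] ->
  (forall m, m \in dom f -> perm_eq (tvars m) [:: x; y; z]) ->
  satisfied_by_pats f ->
  coeff (var_prod x y z) f = coeff (var_prod x z y) f.
Proof.
move=> us fs fP; have sub := dom_sub_orderings us fs.
have [D [a [b [c [nz acb bac bca [cab cba]]]]]] := pats_separation.
have := fP D (fun t => if t == x then a else if t == y then b else c).
rewrite (fglift_sum _ (orderings_uniq us) sub) !big_cons big_nil /= eqxx.
move: us; rewrite /= !inE negb_or !andbT => /andP[/andP[xy xz] yz].
rewrite !(eq_sym y x, eq_sym z x, eq_sym z y) (negPf xy) (negPf xz) (negPf yz).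
rewrite eqxx acb bac bca cab cba !scaler0 !addr0 scalerN -scalerBl.
by move/eqP; rewrite scaler_eq0 (negPf nz) orbF subr_eq0 => /eqP.
Qed.

Lemma tprod_skew (T : ternary_algebra) : satisfies T P_abc ->
  forall a b c : T, tprod a c b = - tprod a b c.
Proof.
move=> TP a b c; apply/eqP; rewrite -addr_eq0 addrC; apply/eqP.
have := TP (fun i => nth 0 [:: a; b; c] i).
by rewrite /P_abc -freeg_cat fglift_Freeg /prelift unlock /= addr0 !scale1r.
Qed.

Local Close Scope ring_scope.

Theorem proposition3p3 (X : choiceType) (n : nat) (f : tpoly X) :
  n <= 3 -> multilinear n f -> satisfied_by_pats f ->
  consequence (fun g : tpoly nat => g = P_abc) f.
Proof.
move=> n3 [s [us sn] fs] fP T /(_ _ erefl)/tprod_skew TP v.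
have shape m : m \in dom f ->
    (exists x, m = TVar x) \/ (exists x y z, m = var_prod x y z).
  by move=> /fs/perm_size ms; apply: tmonomial_small; rewrite ms sn.
case: s us sn fs => [|x [|y [|z [|t s]]]] us sn fs; last by rewrite -sn in n3.
(* Degree 0, and likewise degree 2 below: no monomial has this degree, so the support is empty. *)
- rewrite (@fglift_sum _ _ _ _ _ [::]) ?big_nil // => m mf.
  by case: (shape m mf) (fs m mf) => [[x ->]|[x [y [z ->]]]] /perm_size.
- have sub : {subset dom f <= [:: TVar x]}.
    move=> m mf; case: (shape m mf) (fs m mf) => [[y ->]|[y [z [t ->]]]].
      by move=> /(perm_small_eq (isT : size [:: x] <= 1))[->]; rewrite mem_head.
    by move=> /perm_size.
  have [D [a [b [c [nz _ _ _ _]]]]] := pats_separation.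
  (* Degree 1: [f] is a multiple of one variable, and a nonzero value of that variable forces the
     scalar to be 0. *)
  have := fP D (fun _ => pats a b c).
  rewrite !(fglift_sum _ _ sub) // !big_cons !big_nil /= !addr0 => /eqP.
  by rewrite scaler_eq0 (negPf nz) orbF => /eqP ->; rewrite scale0r.
- rewrite (@fglift_sum _ _ _ _ _ [::]) ?big_nil // => m mf.
  by case: (shape m mf) (fs m mf) => [[t ->]|[t [u [w ->]]]] /perm_size.
have swap p q r : perm_eq [:: p; q; r] [:: x; y; z] ->
    coeff (var_prod p q r) f = coeff (var_prod p r q) f.
  move=> ps; apply: coeff_swap => //; first by rewrite (perm_uniq ps).
  by move=> m /fs mp; apply: perm_trans mp _; rewrite perm_sym.
rewrite (fglift_sum _ (orderings_uniq us) (dom_sub_orderings us fs)).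
rewrite !big_cons big_nil /=.
(* The six terms pair up by first variable; opposite products with equal coefficients cancel. *)
rewrite (TP _ (v y) (v z)) (TP _ (v x) (v z)) (TP _ (v x) (v y)).
have pyxz : perm_eq [:: y; x; z] [:: x; y; z].
  by rewrite -[[:: y; x; z]]/([:: y] ++ [:: x] ++ [:: z]) perm_catCA.
have pzxy : perm_eq [:: z; x; y] [:: x; y; z].
  by rewrite -[[:: z; x; y]]/([:: z] ++ [:: x; y]) perm_catC.
rewrite (swap x y z) // (swap y x z) // (swap z x y) // !scalerN.
by rewrite !(addrA, addr0, subrr, add0r).
Qed.
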